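(* Let $n\ge3$ and $k\ge0$ be integers. Then: (1) If $S$ is a maximal reversible set in $G_n^k$, then $S$ is a maximal independent set in $G_n^k$. (2) If $n>k$ and $S$ is a maximal reversible set in $G_n^k$, then $S$ is a canonical reversible set. (3) If $S$ is a maximal reversible set in $G_n^k$ and $S$ is not a canonical reversible set, then $n\le k$ and \[|S|\le \frac{(k+1)(k+2)}{2}-\frac{n(n-1)}{2}+1.\]
   Context: For integers $n\ge3$, $k\ge0$, the crown $S_n^k$ is the poset with ground set $A\cup B$, $A=\{a_1,\dots,a_{n+k}\}$, $B=\{b_1,\dots,b_{n+k}\}$, indices cyclic modulo $n+k$; elements of $A$ are pairwise incomparable, as are elements of $B$, and $a_i$ is incomparable to $b_j$ when $j\in\{i,i+1,\dots,i+k\}$ (mod $n+k$), while $a_i<b_j$ otherwise. $\mathrm{Inc}(A,B)$ is the set of pairs $(a,b)\in A\times B$ with $a$ incomparable to $b$. The graph $G_n^k$ has vertex set $\mathrm{Inc}(A,B)$, with $(a,b)$ adjacent to $(x,y)$ iff $a<y$ and $x<b$ in $S_n^k$. A set $R\subseteq \mathrm{Inc}(A,B)$ is reversible if there is a linear extension $L$ of $S_n^k$ with $b<a$ in $L$ for all $(a,b)\in R$; a maximal reversible set is one maximal under inclusion among reversible subsets of $\mathrm{Inc}(A,B)$. A subset $X\subseteq A$ is contiguous if it is a block of cyclically consecutive elements of $A$ (the empty set and $A$ count as contiguous). A sequence $\sigma=(x_1,\dots,x_r)$ of distinct elements of $A$ is $h$-contiguous if $\{x_1,\dots,x_i\}$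 is contiguous for every $i\le r$. For such $\sigma$, $T(\sigma)$ is defined recursively: it contains every $(x_1,b)\in\mathrm{Inc}(A,B)$, and for $1\le i<r$ it contains $(x_{i+1},b)$ exactly when $(x_{i+1},b)\in\mathrm{Inc}(A,B)$ and $(x_i,b)\in T(\sigma)$. A canonical reversible set is a set of the form $T(\sigma)$ with $\sigma$ an $h$-contiguous sequence of length $k+1$. *)

(* Defs.v *)
From HB Require Import structures.
From mathcomp Require Import all_boot all_order all_algebra.
Set Implicit Arguments. Unset Strict Implicit. Unset Printing Implicit Defensive.

(* The crown S_n^k.  Indices of A = {a_i} and B = {b_j} are 'I_(n+k)
   (cyclic modulo n+k).  An element a_i is [inl i], b_j is [inr j]. *)
Section Crown.
Variables n k : nat.

Definition idx := 'I_(n + k).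
Definition elt := (idx + idx)%type.

(* a_i is incomparable to b_j iff j \in {i, i+1, ..., i+k} (mod n+k),
   i.e. (j - i) mod (n+k) <= k. *)
Definition incAB (i j : idx) : bool := ((j + (n + k - i)) %% (n + k) <= k)%N.

Definition crown_lt (x y : elt) : bool :=
  match x, y with
  | inl i, inr j => ~~ incAB i j
  | _, _ => false
  end.

(* Inc(A,B), pairs (i,j) standing for (a_i, b_j) *)
Definition IncAB : {set idx * idx} := [set p | incAB p.1 p.2].

Definition Gadj (p q : idx * idx) : bool :=
  crown_lt (inl p.1) (inr q.2) && crown_lt (inl q.1) (inr p.2).

Definition independent (S : {set idx * idx}) : Prop :=
  S \subset IncAB /\ (forall p q, p \in S -> q \in S -> ~~ Gadj p q).

Definition maximal_independent (S : {set idx * idx}) : Prop :=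
  independent S /\
  (forall T, independent T -> S \subset T -> T = S).

Definition linear_extension (L : rel elt) : Prop :=
  irreflexive L /\ transitive L /\
  (forall x y, x != y -> L x y || L y x) /\
  (forall x y, crown_lt x y -> L x y).

Definition reversible (R : {set idx * idx}) : Prop :=
  R \subset IncAB /\
  exists L, linear_extension L /\
    (forall p, p \in R -> L (inr p.2) (inl p.1)).

Definition maximal_reversible (S : {set idx * idx}) : Prop :=
  reversible S /\
  (forall T, reversible T -> S \subset T -> T = S).

(* contiguous subsets of A: cyclic blocks {s, s+1, ..., s+l-1} with
   0 <= l <= n+k (l = 0 gives the empty set, l = n+k gives A) *)
Definition contiguous (X : {set idx}) : Prop :=
  exists (s : idx) (l : nat), (l <= n + k)%N /\
    X = [set i : idx | ((i + (n + k - s)) %% (n + k) < l)%N].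

Definition h_contiguous (sigma : seq idx) : Prop :=
  uniq sigma /\
  (forall i, (i <= size sigma)%N -> contiguous [set x in take i sigma]).

(* T(sigma), following the recursive definition: Bprev is the set of b
   with (x_i, b) \in T(sigma) for the previous element x_i (all of B
   at the start). *)
Fixpoint Tfrom (Bprev : {set idx}) (sigma : seq idx) : {set idx * idx} :=
  match sigma with
  | [::] => set0
  | x :: s' =>
      let Bx := [set b in Bprev | incAB x b] in
      [set p | (p.1 == x) && (p.2 \in Bx)] :|: Tfrom Bx s'
  end.

Definition Tsig (sigma : seq idx) : {set idx * idx} := Tfrom setT sigma.

Definition canonical_reversible (S : {set idx * idx}) : Prop :=
  exists sigma : seq idx,
    h_contiguous sigma /\ size sigma = k.+1 /\ S = Tsig sigma.

End Crown.

(* Main.v *)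
(** Write [I(a)] for the set of [b] incomparable to [a]. Listing [A] from the top
    of a linear extension downwards as [x_1, x_2, ...], the reversed pairs all
    lie in [T(x_1, x_2, ...)], where [x_i] is paired with the intersection [S_i]
    of [I(x_1), ..., I(x_i)]; so maximal reversible sets are the maximal
    [T(sigma)] over orderings [sigma] of [A]. If [S_j] is contained in [I(a)] for
    some later [a], moving [a] in front of [x_j] does not shrink [T(sigma)], so
    maximality forces [S_(j-1)] to meet [I(a)] and [I(x_j)] in the same set.
    This gives (1).

    As long as [{x_1, ..., x_i}] is an arc, [S_i] is an arc of [k + 2 - i]
    elements, and [T(sigma)] is canonical if this persists up to [i = k + 1].
    At the first failure [x_(i+1)], moving a neighbour of the arc forward shows
    that the [n - 1] elements outside [I(x_(i+1))] lie in [S_i], away from both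
    its ends; hence [n <= k] and [S_(i+1)] has [n - 2] elements fewer than in the
    canonical case. The same exchange argument makes the next step strictly
    decreasing, so the deficit is still at least [n - 2] there; from then on it
    drops by at most one per step, and it adds up to at least
    [(n-2) + (n-2) + (n-3) + ... + 1 = n(n-1)/2 - 1]. *)

Require Import Defs.
From mathcomp Require Import all_boot all_order all_algebra.
From mathcomp Require Import zify lra.
Import GRing.Theory Num.Theory.

Set Implicit Arguments. Unset Strict Implicit. Unset Printing Implicit Defensive.

(** * Cyclic offsets between indices *)

Section CyclicDistance.
Variables n k : nat.
Implicit Types (i j s x y : idx n k).

Definition cdist i j : nat := (j + (n + k - i)) %% (n + k).

Lemma cdistP i j :
  (i <= j)%N /\ cdist i j = (j - i)%N \/ (j < i)%N /\ cdist i j = (j + (n + k) - i)%N.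
Proof.
have li : (i < n + k)%N := ltn_ord i; have lj : (j < n + k)%N := ltn_ord j.
rewrite /cdist; case: (leqP i j) => lij; [left | right]; split => //.
  have -> : (j + (n + k - i) = (j - i) + (n + k))%N by lia.
  by rewrite modnDr modn_small //; lia.
by rewrite addnBA ?modn_small //; lia.
Qed.

Lemma incABE i j : incAB i j = (cdist i j <= k)%N.
Proof. by []. Qed.

Lemma ltn_cdist i j : (cdist i j < n + k)%N.
Proof. by have := cdistP i j; have := ltn_ord i; have := ltn_ord j; lia. Qed.

Lemma cdist_inj s : injective (cdist s).
Proof.
move=> x y E; apply: val_inj => /=.
have := cdistP s x; have := cdistP s y; have := ltn_ord x; have := ltn_ord y.
have := ltn_ord s; lia.
Qed.

Lemma cdist_surj s e : (e < n + k)%N -> exists x, cdist s x = e.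
Proof.
move=> le; have ls : (s < n + k)%N := ltn_ord s.
have [h|h] := ltnP (s + e) (n + k).
  exists (Ordinal h : idx n k); have := cdistP s (Ordinal h : idx n k) => /=; lia.
have h' : (s + e - (n + k) < n + k)%N by lia.
by exists (Ordinal h' : idx n k); have := cdistP s (Ordinal h' : idx n k) => /=; lia.
Qed.

(** Puts all indices on one scale with origin [s], so that cyclic comparisons become linear
    arithmetic. *)
Lemma cdist_from s x y :
  (cdist s x <= cdist s y)%N /\ cdist x y = (cdist s y - cdist s x)%N \/
  (cdist s y < cdist s x)%N /\ cdist x y = (cdist s y + (n + k) - cdist s x)%N.
Proof.
have := cdistP s x; have := cdistP s y; have := cdistP x y.
have := ltn_ord x; have := ltn_ord y; have := ltn_ord s; lia.
Qed.

Lemma cdistxx s : cdist s s = 0%N.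
Proof. have := cdistP s s; have := ltn_ord s; lia. Qed.

Lemma succ_closed_setT (Y : {set idx n k}) y0 :
  y0 \in Y -> (forall y y', y \in Y -> cdist y y' = 1%N -> y' \in Y) -> Y = setT.
Proof.
move=> Y0 cl; apply/setP => y; rewrite inE.
move E: (cdist y0 y) => e; elim: e y E => [|e IH] y E.
  by rewrite (_ : y = y0) //; apply: (@cdist_inj y0); rewrite cdistxx.
have [|z Ez] := @cdist_surj y0 e; first by have := ltn_cdist y0 y; lia.
apply: (cl z) => //; first exact: IH.
by have := cdist_from y0 z y; lia.
Qed.

End CyclicDistance.

(** * Common incomparable sets of prefixes, and their sizes *)

Section Common.
Variables n k : nat.
Implicit Types (x y a b s : idx n k) (p q sigma : seq (idx n k)).

Definition common p : {set idx n k} := [set b : idx n k | all (fun x : idx n k => incAB x b) p].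

Lemma mem_common p b : (b \in common p) = all (fun x => incAB x b) p.
Proof. by rewrite inE. Qed.

Lemma common_take_mono p i j :
  (i <= j)%N -> common (take j p) \subset common (take i p).
Proof.
move=> lij; apply/subsetP => b; rewrite !mem_common => /allP h; apply/allP => x hx.
by apply: h; move: hx; rewrite -{1}(take_takel p lij); exact: mem_take.
Qed.

Definition within (m : nat) p : {set idx n k} :=
  [set b : idx n k | all (fun x : idx n k => cdist x b <= m)%N p].

(* For [m = k] this bounds [common p]. Going down from [m = n + k - 2], where
   the set is the complement of the translate [p - 1], each step loses an
   element, as the set for [m] and its translate by 1 lie in the set for [m + 1]. *)
Lemma card_cdist_le p m : uniq p -> p != [::] -> (m + 2 <= n + k)%N ->
  within m p != set0 ->
  (size p + #|within m p| <= m + 2)%N.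
Proof.
move=> up p0; move E: (n + k - 2 - m)%N => t.
elim: t m E => [|t IH] m E lm ne0.
  have -> : m = (n + k - 2)%N by lia.
  set Y := within _ _.
  have : (size p + #|Y| <= #|{: idx n k}|)%N; last by rewrite card_ord; lia.
  (* [f x] is the cyclic predecessor of [x], the only index farther than [n + k - 2] from [x]; by
     [fP] the default [x] is never taken. *)
  pose f (x : idx n k) := odflt x [pick y | cdist y x == 1%N].
  have fP x : cdist (f x) x = 1%N.
    rewrite /f; case: pickP => [y /eqP //|no].
    have [|y Ey] := @cdist_surj n k x (n + k - 1); first by lia.
    by have := no y; have := cdist_from x y x; rewrite cdistxx Ey; lia.
  have fI : injective f.
    by move=> x y e; apply: (@cdist_inj n k (f x)); rewrite fP e fP.
  have /card_uniqP : uniq (map f p) by rewrite map_inj_uniq.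
  rewrite size_map => <-; rewrite -[#|map f p|]cardsE -cardsUI (_ : _ :&: _ = set0) ?cards0 ?addn0 ?max_card //.
  apply/setP => y; rewrite !inE; apply/negP => /andP[/mapP[x xp ->] /allP /(_ _ xp)].
  by have := fP x; have := cdist_from x (f x) x; rewrite cdistxx; lia.
have [b0 hb0] := set0Pn _ ne0.
have [Y1 ne1] : exists y, y \in within m.+1 p.
  exists b0; move: hb0; rewrite !inE; apply: sub_all => x /=; lia.
have := IH m.+1 ltac:(lia) ltac:(lia).
have -> : within m.+1 p != set0 by apply/set0Pn; exists Y1.
move/(_ isT).
suff : within m p \proper
       within m.+1 p.
  by move/proper_card; lia.
rewrite properEneq; apply/andP; split; last first.
  by apply/subsetP => b; rewrite !inE; apply: sub_all => x /=; lia.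
(* With no loss the set would be closed under successor, hence everything, yet it misses the
   predecessor of each element of [p]. *)
apply/eqP => eY.
have full := succ_closed_setT hb0.
have {}full : within m p = setT.
  apply: full => y y' hy d1; rewrite eY; move: hy; rewrite !inE.
  apply: sub_all => x /= hx.
  by have := cdist_from x y y'; lia.
case: p p0 full {up IH ne0 b0 hb0 Y1 ne1 eY} => // x p _ full.
have [|y Ey] := @cdist_surj n k x (n + k - 1); first by lia.
by move/setP/(_ y): full; rewrite !inE /= Ey; lia.
Qed.

Lemma card_common p : (2 <= n)%N -> uniq p -> p != [::] ->
  common p != set0 -> (size p + #|common p| <= k + 2)%N.
Proof. by move=> hn up p0 c0; apply: card_cdist_le => //; lia. Qed.

Lemma card_common_sub p : (2 <= n)%N -> uniq p -> p != [::] ->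
  (#|common p| <= k + 2 - size p)%N.
Proof.
move=> hn up p0; have [->|c0] := eqVneq (common p) set0; first by rewrite cards0.
by have := card_common hn up p0 c0; lia.
Qed.

(** A later repetition of [a] meets a common set that is no larger, so the first occurrence
    decides. *)
Lemma mem_Tfrom (C : {set idx n k}) sigma a b :
  ((a, b) \in Tfrom C sigma) =
  [&& a \in sigma, b \in C & b \in common (take (index a sigma).+1 sigma)].
Proof.
elim: sigma C => [|x s IH] C; first by rewrite !inE.
rewrite [Tfrom _ _]/= 2!inE IH !mem_common !inE /= (eq_sym x).
case: (eqVneq a x) => [->|ne] /=.
  rewrite take0 /= andbT; case: (b \in C); case: (incAB x b); rewrite /= ?andbF //.
by case: (b \in C); case: (incAB x b); rewrite /= ?andbF.
Qed.

Lemma mem_Tsig sigma a b :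
  ((a, b) \in Tsig sigma) =
  (a \in sigma) && (b \in common (take (index a sigma).+1 sigma)).
Proof. by rewrite mem_Tfrom inE. Qed.

Lemma mem_Tsig_cat p a q b : uniq (p ++ a :: q) ->
  ((a, b) \in Tsig (p ++ a :: q)) = (b \in common p) && incAB a b.
Proof.
move=> up; rewrite mem_Tsig mem_cat mem_head orbT /=.
have na : a \notin p.
  by move: up; rewrite cat_uniq => /and3P[_ /hasPn /(_ _ (mem_head _ _))].
rewrite index_cat (negPf na) /= eqxx addn0 -cat_rcons -(size_rcons p a).
by rewrite take_size_cat // !mem_common all_rcons andbC.
Qed.

Lemma Tsig_sub_IncAB sigma : Tsig sigma \subset IncAB n k.
Proof.
apply/subsetP => -[a b]; rewrite mem_Tsig mem_common => /andP[ha /allP hb].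
by rewrite inE; apply: hb; rewrite in_take // ltnS.
Qed.

Lemma card_Tsig_le sigma :
  (#|Tsig sigma| <= \sum_(i < size sigma) #|common (take i.+1 sigma)|)%N.
Proof.
have gen (C : {set idx n k}) : (#|Tfrom C sigma| <=
    \sum_(i < size sigma) #|C :&: common (take i.+1 sigma)|)%N.
  elim: sigma C => [|x s IH] C; first by rewrite cards0.
  rewrite [Tfrom _ _]/= big_ord_recl /= take0 cardsU; apply: leq_trans (leq_subr _ _) _.
  apply: leq_add.
    set E := [set b in C | _]; have -> : C :&: common [:: x] = E.
      by apply/setP => b; rewrite !inE /= andbT.
    rewrite -(card_imset E (_ : injective (fun b => (x, b)))); last by move=> ? ? [].
    apply: subset_leq_card; apply/subsetP => -[a b]; rewrite inE /= => /andP[/eqP -> hb].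
    exact: imset_f.
  apply: leq_trans (IH _) _; apply: leq_sum => i _; apply: subset_leq_card.
  by apply/subsetP => b; rewrite !inE /= => /andP[/andP[-> ->]].
by have := gen setT; under eq_bigr => i _ do rewrite setTI.
Qed.

End Common.

(** * Reversible sets and orderings of [A] *)

Section Reversible.
Variables n k : nat.
Implicit Types (x y a b s : idx n k) (p q sigma : seq (idx n k)).
Implicit Types (R S T : {set idx n k * idx n k}).

Lemma in_split x p : x \in p -> exists p1 p2, p = p1 ++ x :: p2.
Proof. by case/splitPr => p1 p2; exists p1, p2. Qed.

(** Serves to build a linear extension: elements of [A] get odd multiples of [N], elements of [B]
    even multiples plus their index as a tie-breaker. *)
Lemma interleaved_key_ltn (N i m b : nat) : (b < N)%N ->
  ((i.*2.+1 * N < m.*2 * N + b) = (i < m))%N.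
Proof.
move=> lb; apply/idP/idP => [|lim].
  by apply: contraLR; rewrite -!leqNgt => lmi; have := leq_mul2r N m i; rewrite lmi orbT; lia.
have := leq_mul2r N i.+1 m; rewrite lim orbT; lia.
Qed.

Lemma Tsig_reversible sigma : (forall x, x \in sigma) -> reversible (Tsig sigma).
Proof.
move=> full; split; first exact: Tsig_sub_IncAB.
pose m b := find (fun x => ~~ incAB x b) sigma.
(* Larger keys are lower: [b] sits right below the last [x_i] whose whole
   prefix is incomparable to it. *)
pose key (u : elt n k) := match u with
  | inl x => ((index x sigma).*2.+1 * (n + k))%N
  | inr b => ((m b).*2 * (n + k) + b)%N end.
have lb b : (b < n + k)%N := ltn_ord b.
have key_inj : injective key.
  have par (c d : nat) b : (c.*2.+1 * (n + k))%N <> (d.*2 * (n + k) + b)%N.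
    have := interleaved_key_ltn c d (lb b) => h e; move: h; rewrite e ltnn => /esym/negbT.
    rewrite -leqNgt => l; have := leq_mul2r (n + k) d c; rewrite l orbT.
    have := lb b; lia.
  move=> [x|b] [y|c] /=.
  - have := lb x; move=> l /eqP; rewrite eqn_pmul2r; last by lia.
    move/eqP => [] /double_inj e; congr inl.
    by rewrite -(nth_index x (full x)) e nth_index.
  - by move/par.
  - by move/esym/par.
  - move=> e; congr inr; apply: val_inj => /=.
    have := lb b; have := lb c; move: e; case: (ltngtP (m b) (m c)) => [?|?|->]; nia.
exists (fun u v => key v < key u)%N; split; last first.
  move=> [a b]; rewrite mem_Tsig mem_common /= => /andP[_ hall].
  have : (index a sigma < m b)%N.
    rewrite leqNgt; apply/negP => lt; move/allP: hall.
    have hs : has (fun x => ~~ incAB x b) sigma.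
      by rewrite has_find (leq_ltn_trans _ (_ : index a sigma < _)%N) ?index_mem //; lia.
    have := nth_find a hs => /negP hn; move/(_ (nth a sigma (m b))) => h; apply: hn.
    apply: h; rewrite -(nth_take a (n0 := (index a sigma).+1)) //.
    by apply: mem_nth; rewrite size_takel // index_mem.
  by rewrite interleaved_key_ltn.
split; [by move=> u; rewrite ltnn | split; [by move=> v u w h1 h2; exact: ltn_trans h2 h1 | split]].
  move=> u v; apply: contraR; rewrite negb_or -!leqNgt => h.
  by apply/eqP/key_inj/eqP; rewrite eqn_leq.
move=> [a|//] [//|b] /= hab.
have : (m b <= index a sigma)%N.
  rewrite leqNgt; apply/negP => /(before_find a) /negbT.
  by rewrite nth_index // negbK => h; rewrite h in hab.
move=> l; have := leq_mul2r (n + k) (m b) (index a sigma); rewrite l orbT.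
by have := lb b; lia.
Qed.

Lemma reversible_sub_Tsig R : reversible R ->
  exists sigma, [/\ uniq sigma, forall x, x \in sigma & R \subset Tsig sigma].
Proof.
move=> [RI [L [[irr [tr [tot ext]]] rev]]].
pose le x y := (x == y) || L (inl y) (inl x).
have le_tr : transitive le.
  move=> y x z /predU1P[->//|xy] /predU1P[<-|yz]; first by rewrite /le xy orbT.
  by rewrite /le (tr _ _ _ yz xy) orbT.
have le_refl : reflexive le by move=> x; rewrite /le eqxx.
have le_tot : total le.
  move=> x y; rewrite /le; case: (eqVneq x y) => //= ne.
  by rewrite orbC; apply: tot; apply: contra ne => /eqP [->].
exists (sort le (enum {: idx n k})); set sigma := sort _ _.
have full x : x \in sigma by rewrite mem_sort mem_enum.
split=> //; first by rewrite sort_uniq enum_uniq.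
apply/subsetP => -[a b] hab; rewrite mem_Tsig full mem_common /=.
apply/allP => x; rewrite in_take // ltnS => hx.
have := sorted_leq_index le_tr le_refl (sort_sorted le_tot _) x a (full x) (full a) hx.
move=> hle; apply/negPn/negP => ninc.
have xb : L (inl x) (inr b) by apply: ext.
(* [x < b < a] in [L] contradicts [x] being listed no later than [a]. *)
have xa := tr _ _ _ xb (rev _ hab).
move/predU1P: hle => [e|ax]; first by rewrite e irr in xa.
by have := tr _ _ _ xa ax; rewrite irr.
Qed.

Lemma maximal_reversible_Tsig S : maximal_reversible S ->
  exists sigma, [/\ uniq sigma, forall x, x \in sigma & S = Tsig sigma].
Proof.
move=> [rS mS]; have [sigma [us full sub]] := reversible_sub_Tsig rS.
by exists sigma; split=> //; rewrite (mS _ (Tsig_reversible full) sub).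
Qed.

(** * Independence and the exchange argument *)

Lemma reversible_independent R : reversible R -> independent R.
Proof.
move=> [RI [L [[irr [tr [_ ext]]] rev]]]; split=> // p q hp hq.
apply/negP => /andP[/ext pq /ext qp].
(* For [p = (a, b)] and [q = (x, y)] this is the cycle [a < y < x < b < a] in [L]. *)
have pp := tr _ _ _ (tr _ _ _ pq (rev _ hq)) (tr _ _ _ qp (rev _ hp)).
by rewrite irr in pp.
Qed.

(* Otherwise moving [a] to the front of [x] would strictly enlarge [Tsig]. *)
Lemma exchange p x q a : uniq (p ++ x :: q) ->
  (forall z, z \in p ++ x :: q) ->
  maximal_reversible (Tsig (p ++ x :: q)) -> a \in q ->
  (forall b, b \in common p -> incAB x b -> incAB a b) ->
  forall b, b \in common p -> incAB a b -> incAB x b.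
Proof.
move=> us full mr /in_split[q1 [q2 eq0]] sub b pb ab; subst q.
pose tau := p ++ a :: x :: q1 ++ q2.
have pm : perm_eq tau (p ++ x :: q1 ++ a :: q2).
  rewrite /tau perm_cat2l -(cat1s x (q1 ++ a :: q2)) -(cat1s a q2).
  rewrite perm_sym -[X in perm_eq X _]/([:: x] ++ _) catA perm_catCA.
  by rewrite -catA.
have ut : uniq tau by rewrite (perm_uniq pm).
have full' z : z \in tau by rewrite (perm_mem pm).
have memT (r : seq (idx n k)) c r' d sg : uniq sg -> sg = r ++ c :: r' ->
    ((c, d) \in Tsig sg) = (d \in common r) && incAB c d.
  by move=> u e; rewrite e mem_Tsig_cat -?e.
(* Only [x] and the elements of [q1] gain a predecessor, namely [a], and [sub] makes that constraint
   automatic. *)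
have subT : Tsig (p ++ x :: q1 ++ a :: q2) \subset Tsig tau.
  apply/subsetP => -[c d]; have := full c.
  rewrite mem_cat inE mem_cat inE => /or4P[|/eqP->||/orP[/eqP->|]].
  - move=> /in_split[p1 [p2 ep]].
    rewrite (memT p1 c (p2 ++ x :: q1 ++ a :: q2) d _ us); last by rewrite ep -catA.
    by rewrite (memT p1 c (p2 ++ a :: x :: q1 ++ q2) d _ ut) // /tau ep -catA.
  - rewrite (memT p x (q1 ++ a :: q2) d _ us) //.
    rewrite (memT (rcons p a) x (q1 ++ q2) d _ ut) ?cat_rcons //.
    move=> /andP[pd xd]; rewrite mem_common all_rcons -mem_common.
    by rewrite pd xd sub.
  - move=> /in_split[r1 [r2 eq1]].
    rewrite (memT (p ++ x :: r1) c (r2 ++ a :: q2) d _ us); last by rewrite eq1 -?catA /= -?catA.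
    rewrite (memT (p ++ a :: x :: r1) c (r2 ++ q2) d _ ut); last by rewrite /tau eq1 -?catA /= -?catA.
    rewrite !mem_common !all_cat /= -!mem_common => /andP[/and3P[pd xd rd] cd].
    by rewrite pd xd rd cd (sub d).
  - rewrite (memT (p ++ x :: q1) a q2 d _ us) -?catA // (memT p a (x :: q1 ++ q2) d _ ut) //.
    by rewrite !mem_common all_cat => /andP[/andP[-> _] ->].
  - move=> /in_split[r1 [r2 eq2]].
    rewrite (memT (p ++ x :: q1 ++ a :: r1) c r2 d _ us); last by rewrite eq2 -?catA /= -?catA.
    rewrite (memT (p ++ a :: x :: q1 ++ r1) c r2 d _ ut); last by rewrite /tau eq2 -?catA /= -?catA.
    rewrite !mem_common !all_cat /= !all_cat /=.
    by move=> /andP[/and5P[-> -> -> -> ->] ->].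
(* By maximality the pair [(a, b)] was already present in the old order, where [x] precedes [a]. *)
have e := mr.2 _ (Tsig_reversible full') subT.
have : (a, b) \in Tsig tau by rewrite (memT p a (x :: q1 ++ q2)) ?pb.
rewrite e (memT (p ++ x :: q1) a q2) ?us //; last by rewrite -catA.
by rewrite mem_common all_cat /= => /andP[/and3P[]].
Qed.

(* Take the first [x] of [sigma] with [x < b]; independence from the pairs
   [(x, y)] of [S] is exactly the hypothesis of [exchange]. *)
Lemma maximal_reversible_independent S :
  maximal_reversible S -> maximal_independent S.
Proof.
move=> mr; split; first exact: reversible_independent mr.1.
move=> T [TI Tind] sST; apply/eqP; rewrite eqEsubset sST andbT.
have [sigma [us full eS]] := maximal_reversible_Tsig mr.
apply/subsetP => -[a b] abT; apply/negPn/negP => abS.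
have incab : incAB a b by have := subsetP TI _ abT; rewrite inE.
have hs : has (fun x => ~~ incAB x b) sigma.
  apply/negPn/negP => /hasPn h; case/negP: abS; rewrite eS mem_Tsig full mem_common.
  by apply/allP => x /mem_take /h; rewrite negbK.
case: (split_find hs) us full eS => x p q xb; rewrite has_predC negbK => pb.
rewrite cat_rcons => us full eS.
have aq : a \in q.
  have := full a; rewrite mem_cat inE => /or3P[ap|/eqP e|//].
    have [p1 [p2 ep]] := in_split ap; case/negP: abS; rewrite eS.
    rewrite ep -catA mem_Tsig_cat; last by rewrite -cat_cons catA -ep.
    by rewrite mem_common incab andbT; move: pb; rewrite ep all_cat => /andP[].
  by move: xb; rewrite -e incab.
have := @exchange p x q a us full _ aq _ b; rewrite -eS mem_common (negPf xb).
move=> h; suff: false by []; apply: h => // y py xy.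
have xyS : (x, y) \in S by rewrite eS mem_Tsig_cat // py xy.
have := Tind _ _ (subsetP sST _ xyS) abT.
by rewrite /Gadj /= xb /= negbK.
Qed.

(** * Prefixes that form arcs, and the first failure *)

Definition arc_seq s p := forall z, (z \in p) = (cdist s z < size p)%N.

Lemma arc_seq_contiguous s p : arc_seq s p -> (size p <= n + k)%N ->
  contiguous [set z in p].
Proof.
by move=> hs l; exists s, (size p); split=> //; apply/setP => z; rewrite !inE hs.
Qed.

Lemma mem_common_arc s p b : (2 <= n)%N -> arc_seq s p -> (0 < size p <= k.+1)%N ->
  (b \in common p) = ((size p).-1 <= cdist s b <= k)%N.
Proof.
move=> hn hs /andP[p0 pk]; rewrite mem_common; apply/allP/idP => [h|h z].
  have lb : (cdist s b <= k)%N by apply: h; rewrite hs cdistxx.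
  rewrite lb andbT leqNgt; apply/negP => lt.
  have [|z Ez] := @cdist_surj n k s (cdist s b).+1; first by lia.
  have := h z; rewrite hs Ez incABE; have := cdist_from s z b; have := ltn_cdist s z; lia.
by rewrite hs incABE => lz; have := cdist_from s z b; lia.
Qed.

Lemma size_full sigma : uniq sigma -> (forall x, x \in sigma) -> size sigma = (n + k)%N.
Proof.
move=> /card_uniqP <- full; rewrite -[RHS]card_ord; apply: eq_card => x.
by rewrite full.
Qed.

(* If [x] is not adjacent to the arc [p], [exchange] with either neighbour of the
   arc shows that the complement of [I(x)] is disjoint from those already used
   and adjacent to neither end of their union. *)
Lemma arc_step p x q s : (3 <= n)%N -> uniq (p ++ x :: q) ->
  (forall z, z \in p ++ x :: q) -> maximal_reversible (Tsig (p ++ x :: q)) ->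
  (0 < size p <= k)%N -> arc_seq s p ->
  (exists s', arc_seq s' (rcons p x)) \/
  (n + size p <= k.+1)%N /\ (forall b, ~~ incAB x b -> b \in common p).
Proof.
move=> hn us full mr /andP[p0 pk] hs; set i := size p in p0 pk.
have xp : x \notin p.
  by move: us; rewrite cat_uniq => /and3P[_ /hasPn /(_ _ (mem_head _ _))].
have inq a : a \notin p -> a != x -> a \in q.
  by move=> h1 h2; have := full a; rewrite mem_cat inE (negPf h1) (negPf h2).
have le : (i <= cdist s x)%N by rewrite leqNgt /i -hs.
have ltx := ltn_cdist s x.
have cE b : (b \in common p) = (i.-1 <= cdist s b <= k)%N.
  by apply: mem_common_arc => //; lia.
(* Either neighbour of the arc prolongs it; the left one, at offset [n + k - 1], becomes the new
   start. *)
have [ei|nei] := eqVneq (cdist s x) i.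
  left; exists s => z; rewrite mem_rcons inE size_rcons hs -/i ltnS.
  by rewrite [RHS]leq_eqVlt -(inj_eq (@cdist_inj n k s)) ei.
have [eN|neN] := eqVneq (cdist s x) (n + k).-1.
  left; exists x => z; rewrite mem_rcons inE size_rcons hs -/i.
  have [->|ne] := eqVneq z x; first by rewrite cdistxx.
  have : cdist s z != cdist s x by apply: contra ne => /eqP /cdist_inj ->.
  by have := cdist_from s x z; have := ltn_cdist s z; rewrite eN /=; lia.
right.
(* In offsets from [s], [common p] is [i - 1, ..., k] and the complement of [I(x)] is the [n - 1]
   offsets just before [x]. If it reached below [i], the right neighbour of the arc could go before
   [x] and gain offset [i]. *)
have low : (n + i <= (cdist s x).+1)%N.
  rewrite leqNgt; apply/negP => lt.
  have [|a Ea] := @cdist_surj n k s i; first by lia.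
  have [|b Eb] := @cdist_surj n k s i; first by lia.
  have aq : a \in q.
    by apply: inq; rewrite ?hs ?Ea ?ltnn //; apply: contra nei => /eqP <-; rewrite Ea.
  have sub c : c \in common p -> incAB x c -> incAB a c.
    rewrite cE !incABE => hc.
    by have := cdist_from s x c; have := cdist_from s a c; lia.
  have pb : b \in common p by rewrite cE Eb; lia.
  have := exchange us full mr aq sub pb; rewrite !incABE.
  by have := cdist_from s x b; have := cdist_from s a b; lia.
(* Symmetrically, if it reached offset [k], the left neighbour would gain offset [k - 1]. *)
have high : (cdist s x <= k)%N.
  rewrite leqNgt; apply/negP => lt.
  have [|a Ea] := @cdist_surj n k s (n + k).-1; first by lia.
  have [|b Eb] := @cdist_surj n k s k.-1; first by lia.
  have aq : a \in q.
    by apply: inq; rewrite ?hs ?Ea -/i; [lia|apply: contra neN => /eqP <-; rewrite Ea].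
  have sub c : c \in common p -> incAB x c -> incAB a c.
    rewrite cE !incABE => hc.
    by have := cdist_from s x c; have := cdist_from s a c; lia.
  have pb : b \in common p by rewrite cE Eb; lia.
  have := exchange us full mr aq sub pb; rewrite !incABE.
  by have := cdist_from s x b; have := cdist_from s a b; lia.
split; first by lia.
move=> b; rewrite cE incABE; have := cdist_from s x b; have := ltn_cdist s b; lia.
Qed.

(** [I(a)] must avoid both ends of the complement of [I(x)], at offsets [k + 1] and [n + k - 1] from
    [x], which pins down [a]. *)
Lemma incAB_sub_eq x a : (2 <= n <= k)%N ->
  (forall b, incAB a b -> incAB x b) -> a = x.
Proof.
move=> hn h; apply: (@cdist_inj n k x); rewrite cdistxx.
have la := ltn_cdist x a.
have [|y Ey] := @cdist_surj n k x (n + k).-1; first by lia.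
have [|z Ez] := @cdist_surj n k x k.+1; first by lia.
have := h y; have := h z; rewrite !incABE Ey Ez.
have := cdist_from x a y; have := cdist_from x a z; lia.
Qed.

(** Prefixes grow by [arc_step]; the first one that cannot be kept an arc yields the gap. *)
Lemma arc_or_gap sigma : (3 <= n)%N -> uniq sigma -> (forall z, z \in sigma) ->
  maximal_reversible (Tsig sigma) ->
  (forall i, (0 < i <= k.+1)%N -> exists s, arc_seq s (take i sigma)) \/
  exists p x q, [/\ sigma = p ++ x :: q, (0 < size p)%N,
    (n + size p <= k.+1)%N & forall b, ~~ incAB x b -> b \in common p].
Proof.
move=> hn us full mr; set Gap := (X in _ \/ X).
have sz := size_full us full.
suff: forall m, (m <= k)%N -> (forall i, (0 < i <= m.+1)%N ->
    exists s, arc_seq s (take i sigma)) \/ Gap by move/(_ k (leqnn k)).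
elim=> [_|m IH lm].
  left=> i hi; have {i hi} -> : i = 1%N by lia.
  case: sigma us full mr sz @Gap => [|x q] us full mr sz _; first by move: sz => /=; lia.
  exists x => z; rewrite /= take0 inE /= ltnS leqn0.
  by rewrite -(cdistxx x) (inj_eq (@cdist_inj n k x)).
case: (IH (ltnW lm)) => [arcs|]; last by right.
have [|s hs] := arcs m.+1; first by lia.
have lt : (m.+1 < size sigma)%N by lia.
have x0 : idx n k by case: (sigma) lt.
have esig : sigma = take m.+1 sigma ++ nth x0 sigma m.+1 :: drop m.+2 sigma.
  by rewrite -(drop_nth x0) // cat_take_drop.
have szp : size (take m.+1 sigma) = m.+1 by rewrite size_takel // ltnW.
have := @arc_step (take m.+1 sigma) (nth x0 sigma m.+1) (drop m.+2 sigma) s hn.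
rewrite -esig szp => /(_ us full mr lm hs) [[s' hs']|[h1 h2]].
  left=> i hi; case: (leqP i m.+1) => li; first by apply: arcs; lia.
  have -> : i = m.+2 by lia.
  by exists s'; rewrite (take_nth x0).
right; exists (take m.+1 sigma), (nth x0 sigma m.+1), (drop m.+2 sigma).
by split; rewrite ?szp.
Qed.

(** Elements after the first [k + 1] contribute nothing, since by [card_common] any [k + 2] of the
    sets [I(x)] have empty intersection. *)
Lemma Tsig_arcs_canonical sigma : (2 <= n)%N -> uniq sigma ->
  (forall z, z \in sigma) ->
  (forall i, (0 < i <= k.+1)%N -> exists s, arc_seq s (take i sigma)) ->
  canonical_reversible (Tsig sigma).
Proof.
move=> hn us full arcs; have sz := size_full us full.
have szk : size (take k.+1 sigma) = k.+1 by rewrite size_takel //; lia.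
exists (take k.+1 sigma); split; last split=> //.
  split; first exact: take_uniq.
  move=> i; rewrite szk => li; rewrite take_takel //.
  case: i li => [|i] li.
    (* The empty block still needs a start; any index serves. *)
    have [s _] := arcs 1%N isT; exists s, 0%N; split=> //.
    by apply/setP => z; rewrite take0 !inE.
  have [s hs] := arcs i.+1 li; apply: (arc_seq_contiguous hs).
  by rewrite size_takel; lia.
apply/setP => -[a b]; rewrite !mem_Tsig full /=.
have [la|la] := leqP (index a sigma).+1 k.+1.
  have -> : index a (take k.+1 sigma) = index a sigma.
    by rewrite -{2}(cat_take_drop k.+1 sigma) index_cat in_take // la.
  by rewrite in_take // la take_takel.
rewrite in_take // ltnNge -ltnS la /=; apply/negP => hb.
have := @card_common n k (take k.+2 sigma) hn (take_uniq _ us).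
have lk : (k.+2 <= size sigma)%N by lia.
have cb : b \in common (take k.+2 sigma).
  by apply: subsetP hb; exact: common_take_mono.
have c0 : common (take k.+2 sigma) != set0 by apply/set0Pn; exists b.
have -> : take k.+2 sigma != [::] by rewrite -size_eq0 size_takel.
move=> /(_ isT c0); have : (0 < #|common (take k.+2 sigma)|)%N by rewrite card_gt0.
by rewrite size_takel //; lia.
Qed.

(** * Counting the deficit after a gap *)

Lemma sum_subn_ord (a m : nat) : (a <= m)%N -> (2 * \sum_(t < m) (a - t) = a * a.+1)%N.
Proof.
elim: m a => [|m IH] a la; first by rewrite big_ord0; lia.
rewrite big_ord_recl (eq_bigr (fun t : 'I_m => a.-1 - t)%N); last first.
  by move=> t _; rewrite lift0; lia.
by case: a la => [|a] la; rewrite mulnDr IH /= ?subn0; lia.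
Qed.

Lemma gap_bound p x q : (3 <= n)%N -> uniq (p ++ x :: q) ->
  (forall z, z \in p ++ x :: q) -> maximal_reversible (Tsig (p ++ x :: q)) ->
  (0 < size p)%N -> (n + size p <= k.+1)%N ->
  (forall b, ~~ incAB x b -> b \in common p) ->
  (2 * #|Tsig (p ++ x :: q)| + n * n.-1 <= k.+1 * k.+2 + 2)%N.
Proof.
move=> hn us full mr p0 pk gap.
have sz := size_full us full.
set sigma := p ++ x :: q in us full mr sz *; set i := size p in p0 pk.
pose c m := #|common (take m sigma)|.
have cmono m m' : (m <= m')%N -> (c m' <= c m)%N.
  by move=> l; apply: subset_leq_card; exact: common_take_mono.
have cle m : (0 < m <= n + k)%N -> (c m <= k + 2 - m)%N.
  move=> hm; have := @card_common_sub n k (take m sigma) (ltnW hn) (take_uniq _ us).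
  by rewrite -size_eq0 size_takel; [apply; lia | lia].
have tp : take i sigma = p by rewrite take_size_cat.
have tpx : take i.+1 sigma = rcons p x.
  by rewrite /sigma -cat_rcons -(size_rcons p x) take_size_cat.
(* All of the at least [n - 1] elements outside [I(x)] lie in [common p] and are lost at once. *)
have c1 : (c i.+1 + n.-1 <= c i)%N.
  have Ix : (#|common [:: x]| <= k + 2 - 1)%N by apply: card_common_sub => //; lia.
  have : (c i.+1 + #|~: common [:: x]| <= c i)%N.
    rewrite /c tp tpx.
    have -> : common (rcons p x) = common p :&: common [:: x].
      by apply/setP => b; rewrite !inE /= all_rcons andbT andbC.
    rewrite -(cardsID (common [:: x]) (common p)) leq_add2l.
    apply: subset_leq_card; apply/subsetP => b; rewrite !inE /= andbT => nb.
    by rewrite nb -mem_common gap.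
  have := cardsC (common [:: x]); rewrite card_ord; lia.
(* If the next element [a] lost nothing, [exchange] and [gap] would give that [I(a)] is contained in
   [I(x)], hence [a = x]. *)
have c2 : (c i.+2 < c i.+1)%N.
  have lq : (0 < size q)%N by move: sz; rewrite /sigma size_cat /=; rewrite -/i; lia.
  case eq: q lq => [//|a q'] _.
  have aq : a \in q by rewrite eq mem_head.
  apply: proper_card; rewrite properE common_take_mono //=; apply/negP => /subsetP sub.
  have ne : a != x.
    move: us; rewrite /sigma cat_uniq eq /= => /and3P[_ _ /andP[/norP[h _] _]].
    by rewrite eq_sym.
  case/eqP: ne; apply: incAB_sub_eq; first by lia.
  have tpa : take i.+2 sigma = rcons (rcons p x) a.
    rewrite /sigma eq -!cat_rcons -[i.+2](_ : size (rcons (rcons p x) a) = _); last first.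
      by rewrite !size_rcons.
    by rewrite take_size_cat.
  have ex := exchange us full mr aq _.
  have {}ex b : b \in common p -> incAB a b -> incAB x b.
    apply: ex => d pd xd; have := sub d; rewrite tpx tpa !mem_common !all_rcons.
    by rewrite xd -mem_common pd => /(_ isT) /andP[].
  move=> b ab; apply/negPn/negP => nb; move/negP: (nb); apply.
  by apply: ex => //; apply: gap.
(* [g t] bounds from below the deficit of [c t.+1] relative to a canonical set. *)
pose g t := (if t < i then 0 else if t == i then n - 2 else n - 2 - (t - i.+1))%N.
have cg t : (t < n + k)%N -> (c t.+1 + g t <= k.+1 - t)%N.
  move=> lt; have := cle t.+1 ltac:(lia); have := cle i ltac:(lia).
  rewrite /g; case: ltnP => h1 ; first by lia.
  case: eqVneq => [->|ne]; first by lia.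
  (* From here [c] need only be non-increasing while the canonical size drops by one per step. *)
  by have := cmono i.+2 t.+1 ltac:(lia); lia.
have card_le : (#|Tsig sigma| <= \sum_(t < n + k) c t.+1)%N.
  by have := card_Tsig_le sigma; rewrite sz.
have sumcg : (\sum_(t < n + k) c t.+1 + \sum_(t < n + k) g t <= \sum_(t < n + k) (k.+1 - t))%N.
  by rewrite -big_split /=; apply: leq_sum => t _; apply: cg.
(* The first summand comes from [t = i], the second is the doubled triangular sum over [t > i]. *)
have sumg : (2 * (n - 2) + (n - 2) * (n - 1) <= 2 * \sum_(t < n + k) g t)%N.
  have -> : (n + k = i + (n + k - i.+1).+1)%N by lia.
  rewrite big_split_ord /= big_ord_recl /=.
  have -> : (g (i + 0) = n - 2)%N by rewrite /g addn0 ltnn eqxx.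
  rewrite [X in (_ + (_ + X))%N](eq_bigr (fun t : 'I__ => n - 2 - t)%N); last first.
    move=> t _; rewrite /g /bump /=; case: ltnP => h; first by lia.
    by case: eqVneq => h'; lia.
  rewrite !mulnDr sum_subn_ord; last by lia.
  have -> : ((n - 2).+1 = n - 1)%N by lia.
  by lia.
(* The canonical sizes vanish past [k + 1] by truncation, so they sum to a triangular number. *)
have := @sum_subn_ord k.+1 (n + k) ltac:(lia).
have -> : (n * n.-1 = 2 * (n - 2) + (n - 2) * (n - 1) + 2)%N by nia.
lia.
Qed.

End Reversible.

Lemma natr_halves_le (c u v : nat) : (2 * c + v <= u + 2)%N ->
  ((c%:R : rat) <= (u%:R / 2 - v%:R / 2 + 1)%R)%R.
Proof. by rewrite -(ler_nat rat) natrD (natrM rat 2) natrD; lra. Qed.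

Theorem theorem1p3 (n k : nat) (hn : (3 <= n)%N) :
  (forall S : {set idx n k * idx n k},
      maximal_reversible S -> maximal_independent S) /\
  ((k < n)%N -> forall S : {set idx n k * idx n k},
      maximal_reversible S -> canonical_reversible S) /\
  (forall S : {set idx n k * idx n k},
      maximal_reversible S -> ~ canonical_reversible S ->
      (n <= k)%N /\
      ((#|S|%:R : rat) <= ((k.+1 * k.+2)%:R / 2 - (n * n.-1)%:R / 2 + 1)%R)%R).
Proof.
split; first exact: maximal_reversible_independent.
split=> [kn|] S mr; have [sigma [us full eS]] := maximal_reversible_Tsig mr; subst S.
  (* A gap after a nonempty prefix would force [n <= k]. *)
  case: (arc_or_gap hn us full mr) => [|[p [x [q [_ p0 pk _]]]]]; last by lia.
  by apply: Tsig_arcs_canonical => //; exact: ltnW.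
case: (arc_or_gap hn us full mr) => [arcs []|[p [x [q [e p0 pk gap]]]] _].
  by apply: Tsig_arcs_canonical => //; exact: ltnW.
split; first by lia.
by subst sigma; apply: natr_halves_le; exact: gap_bound.
Qed.
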